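(* For every integer $q\ge 7$, the group $G_q=BS(1,q)=\langle a,t \mid tat^{-1}=a^q\rangle$ is not $MAC$ with respect to the generating set $A=\{a,a^{-1},t,t^{-1}\}$.
   Context: For a group $G$ with finite generating set $A$, let $\Gamma$ be the corresponding Cayley graph, regarded as a metric graph with path metric $d$ (each edge has length 1), and let $S(r)$ and $B(r)$ denote the sphere and the (closed) ball of radius $r$ in $\Gamma$ centred at the identity vertex. For a function $f:\mathbb{N}\to\mathbb{R}_+$ and $r_0\in\mathbb{N}$, the pair $(G,A)$ satisfies the condition $AC_{f,r_0}$ if for every natural number $r\ge r_0$ and every pair of vertices $a,b\in S(r)$ with $d(a,b)\le 2$ there is a path inside $B(r)$ from $a$ to $b$ of length at most $f(r)$. The pair $(G,A)$ is minimally almost convex, or $MAC$, if $AC_{f,r_0}$ holds for the function $f(r)=2r-1$ and some $r_0\in\mathbb{N}$. *)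

(* Defs.v *)
From HB Require Import structures.
From mathcomp Require Import all_boot all_order all_algebra.
From mathcomp Require Import boolp classical_sets reals.

Set Implicit Arguments.
Unset Strict Implicit.
Unset Printing Implicit Defensive.

Import Order.TTheory GRing.Theory Num.Theory.

Local Open Scope ring_scope.
Local Open Scope group_scope.

(* The letter (i, false) stands for the generator i and (i, true) for its
   inverse; a word stands for the product of its letters. *)
Definition word (I : choiceType) := seq (I * bool)%type.

Definition inv_letter (I : choiceType) (l : I * bool) : I * bool :=
  (l.1, ~~ l.2).

Definition inv_word (I : choiceType) (w : word I) : word I :=
  rev (map (@inv_letter I) w).

(* [pcongr rels] is the least monoid congruence on words that contains free
   reduction and all the pairs related by [rels]. *)
Inductive pcongr (I : choiceType) (rels : word I -> word I -> Prop) :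
    word I -> word I -> Prop :=
| pcongr_refl u : pcongr rels u u
| pcongr_sym u v : pcongr rels u v -> pcongr rels v u
| pcongr_trans u v w : pcongr rels u v -> pcongr rels v w -> pcongr rels u w
| pcongr_ctx x u v y :
    pcongr rels u v -> pcongr rels (x ++ u ++ y) (x ++ v ++ y)
| pcongr_free l : pcongr rels [:: l; inv_letter l] [::]
| pcongr_rel u v : rels u v -> pcongr rels u v.

Section Presented.
Variables (I : choiceType) (rels : word I -> word I -> Prop).

Local Notation congr := (pcongr rels).

Definition pcongrb : rel (word I) := fun u v => `[< congr u v >].

Lemma pcongrb_refl : reflexive pcongrb.
Proof. by move=> u; apply/asboolP/pcongr_refl. Qed.

Lemma pcongrb_sym : symmetric pcongrb.
Proof. by move=> u v; apply/asboolP/asboolP => /pcongr_sym. Qed.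

Lemma pcongrb_trans : transitive pcongrb.
Proof.
by move=> v u w /asboolP uv /asboolP vw; apply/asboolP/(pcongr_trans uv vw).
Qed.

Canonical pcongr_equiv := EquivRel pcongrb pcongrb_refl pcongrb_sym pcongrb_trans.

Definition presented := {eq_quot pcongr_equiv}%qT.

HB.instance Definition _ := Choice.on presented.
HB.instance Definition _ := EqQuotient.on presented.

Definition pword (w : word I) : presented := (\pi_presented w)%qT.

Definition pgen (i : I) : presented := pword [:: (i, false)].

Lemma pwordP (u v : word I) : pword u = pword v <-> congr u v.
Proof.
split=> [/eqP|uv]; first by rewrite /pword eqmodE => /asboolP.
by apply/eqP; rewrite /pword eqmodE; apply/asboolP.
Qed.

Lemma pword_repr (x : presented) : pword (repr x) = x.
Proof. exact: reprK. Qed.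

Lemma pcongr_cat u u' v v' :
  congr u u' -> congr v v' -> congr (u ++ v) (u' ++ v').
Proof.
move=> uu' vv'; apply: (@pcongr_trans _ _ _ (u' ++ v)).
  exact: (pcongr_ctx [::] v uu').
by have := pcongr_ctx u' [::] vv'; rewrite !cats0.
Qed.

Lemma inv_letterK : involutive (@inv_letter I).
Proof. by case=> i b; rewrite /inv_letter /= negbK. Qed.

Lemma inv_wordK : involutive (@inv_word I).
Proof. by move=> w; rewrite /inv_word map_rev revK (mapK inv_letterK). Qed.

Lemma pcongr_mulV w : congr (w ++ inv_word w) [::].
Proof.
elim: w => [|l w IH] /=; first exact: pcongr_refl.
rewrite /inv_word /= rev_cons -cats1 catA.
apply: pcongr_trans (pcongr_free _ l).
exact: (pcongr_ctx [:: l] [:: inv_letter l] IH).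
Qed.

Lemma pcongr_mulVl w : congr (inv_word w ++ w) [::].
Proof. by have := pcongr_mulV (inv_word w); rewrite inv_wordK. Qed.

Definition pone : presented := pword [::].
Definition pmul (x y : presented) : presented := pword (repr x ++ repr y).
Definition pinv (x : presented) : presented := pword (inv_word (repr x)).

Lemma pmulE u v : pmul (pword u) (pword v) = pword (u ++ v).
Proof. by apply/pwordP/pcongr_cat; apply/pwordP/pword_repr. Qed.

Lemma pmulA : associative pmul.
Proof.
move=> x y z; rewrite -(pword_repr x) -(pword_repr y) -(pword_repr z).
by rewrite !pmulE catA.
Qed.

Lemma pmul1 : left_id pone pmul.
Proof. by move=> x; rewrite -(pword_repr x) pmulE. Qed.

Lemma pmulr1 : right_id pone pmul.
Proof. by move=> x; rewrite -(pword_repr x) pmulE cats0. Qed.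

Lemma pmulV : left_inverse pone pinv pmul.
Proof.
by move=> x; rewrite -{2}(pword_repr x) pmulE; apply/pwordP/pcongr_mulVl.
Qed.

Lemma pmulrV : right_inverse pone pinv pmul.
Proof.
by move=> x; rewrite -{1}(pword_repr x) pmulE; apply/pwordP/pcongr_mulV.
Qed.

HB.instance Definition _ :=
  isGroup.Build presented pmulA pmul1 pmulr1 pmulV pmulrV.

Lemma pwordM u v : pword (u ++ v) = pword u * pword v.
Proof. by rewrite -pmulE. Qed.

Lemma pword1 : pword [::] = 1.
Proof. by []. Qed.

Lemma pwordV w : pword (inv_word w) = (pword w)^-1.
Proof.
apply: (mulIg (pword w)); rewrite mulVg -pwordM -pword1.
exact/pwordP/pcongr_mulVl.
Qed.

Lemma pword_gens w :
  pword w = \prod_(l <- w) (if l.2 then (pgen l.1)^-1 else pgen l.1).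
Proof.
elim: w => [|[i b] w IH]; first by rewrite big_nil.
rewrite big_cons -IH -cat1s pwordM; congr (_ * _).
by case: b => //=; rewrite -pwordV.
Qed.

Lemma presented_gen (x : presented) :
  exists w : word I,
    x = \prod_(l <- w) (if l.2 then (pgen l.1)^-1 else pgen l.1).
Proof. by exists (repr x); rewrite -pword_gens pword_repr. Qed.

Section Universal.
Variables (H : groupType) (h : I -> H).

Definition weval (w : word I) : H :=
  \prod_(l <- w) (if l.2 then (h l.1)^-1 else h l.1).

Hypothesis hrel : forall u v, rels u v -> weval u = weval v.

Lemma weval_congr u v : congr u v -> weval u = weval v.
Proof.
elim=> //.
- by move=> u' v' w' _ -> _ ->.
- by move=> x u' v' y _ E; rewrite /weval !big_cat /=; rewrite /weval in E;
    rewrite E.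
- case=> i b; rewrite /weval /inv_letter big_cons big_cons !big_nil mulg1 /=.
  by case: b => /=; rewrite ?mulgV ?mulVg.
Qed.

Lemma presented_lift :
  exists f : presented -> H,
    {morph f : x y / x * y} /\ (forall i, f (pgen i) = h i).
Proof.
exists (fun x => weval (repr x)).
have fE w : weval (repr (pword w)) = weval w.
  by apply/weval_congr/pwordP/pword_repr.
split=> [x y|i]; last by rewrite fE /weval big_seq1.
by rewrite -{1}(pword_repr x) -{1}(pword_repr y) -pwordM fE /weval big_cat.
Qed.

End Universal.
End Presented.

(* BS(m, n) = < a, t | t a^m t^-1 = a^n >. The two generators are indexed by
   bool: true is a and false is t. *)
Variant bs_rel (m n : nat) : word bool -> word bool -> Prop :=
| BSRel : bs_rel m n
    ((false, false) :: nseq m (true, false) ++ [:: (false, true)])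
    (nseq n (true, false)).

Definition BS (m n : nat) : groupType := presented (bs_rel m n).

Definition bs_a (m n : nat) : BS m n := pgen (bs_rel m n) true.
Definition bs_t (m n : nat) : BS m n := pgen (bs_rel m n) false.

Definition bs_gens (m n : nat) : seq (BS m n) :=
  [:: bs_a m n; (bs_a m n)^-1; bs_t m n; (bs_t m n)^-1].

Lemma bs_relation m n :
  bs_t m n * bs_a m n ^+ m * (bs_t m n)^-1 = bs_a m n ^+ n.
Proof.
have powE k : bs_a m n ^+ k = pword (bs_rel m n) (nseq k (true, false)).
  elim: k => [|k IH]; first by rewrite expg0 -pword1.
  by rewrite expgS IH -pwordM.
have /pwordP := pcongr_rel (BSRel m n).
by rewrite -cat1s !pwordM -!powE mulgA (pwordV _ [:: (false, false)]).
Qed.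

Lemma bs_gens_generate m n (x : BS m n) :
  exists2 s : seq (BS m n), {subset s <= bs_gens m n} & x = \prod_(g <- s) g.
Proof.
have [w ->] := presented_gen x.
exists [seq (if l.2 then (pgen (bs_rel m n) l.1)^-1
             else pgen (bs_rel m n) l.1) | l <- w]; last by rewrite big_map.
move=> _ /mapP[[b e] _ ->]; rewrite !inE.
by case: b; case: e => /=; rewrite eqxx ?orbT.
Qed.

Section Cayley.
Variables (R : realType) (G : groupType) (A : seq G).

(* The edges are unoriented: g and h are joined when h = g s or g = h s for
   some s in A. *)
Definition cayley_adj : rel G :=
  fun g h => (g^-1 * h \in A) || (h^-1 * g \in A).

(* d(g, h) <= n, for vertices g and h. *)
Definition cayley_dist_le (g h : G) (n : nat) : Prop :=
  exists p : seq G, [/\ path cayley_adj g p, last g p = h & (size p <= n)%N].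

(* The vertices of S(r), i.e. those with d(1, g) = r. *)
Definition cayley_sphere (r : nat) : set G :=
  [set g | cayley_dist_le 1 g r /\
           forall n, cayley_dist_le 1 g n -> (r <= n)%N]%classic.

(* A point of the metric graph is encoded by a triple (g, h, x), standing for
   the point at distance x from g on the edge of length 1 that joins g to h;
   the vertex g is (g, h, 0). A path from 1 to this point arrives
   through g or through h, so that its distance to 1 is the minimum of
   d(1, g) + x and d(1, h) + (1 - x). *)
Definition cayley_point : set (G * G * R) :=
  [set p | cayley_adj p.1.1 p.1.2 /\ (0 <= p.2 <= 1)%R]%classic.

Definition cayley_ball (r : R) : set (G * G * R) :=
  [set p | cayley_point p /\ exists n : nat,
    (cayley_dist_le 1 p.1.1 n /\ (n%:R + p.2 <= r)%R) \/
    (cayley_dist_le 1 p.1.2 n /\ (n%:R + (1 - p.2) <= r)%R)]%classic.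

(* All the points of the edge, not only its endpoints, must be in the ball. *)
Definition edge_in_ball (r : R) : rel G := fun g h =>
  cayley_adj g h &&
  `[< forall x : R, (0 <= x <= 1)%R -> cayley_ball r (g, h, x) >].

(* The condition AC_{f, r0}. *)
Definition almost_convex (f : nat -> R) (r0 : nat) : Prop :=
  forall r : nat, (r0 <= r)%N ->
  forall a b : G, cayley_sphere r a -> cayley_sphere r b ->
    cayley_dist_le a b 2 ->
  exists p : seq G,
    [/\ path (edge_in_ball r%:R) a p, last a p = b & ((size p)%:R <= f r)%R].

Definition MAC : Prop :=
  exists r0 : nat, almost_convex (fun r => 2 * r%:R - 1)%R r0.

End Cayley.

(* Main.v *)
(** The group acts on the line by affine maps: a is x |-> x + 1 and t is
x |-> q x, so that a group element has a translation part x and a height h, and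
a horizontal step at height h changes x by q^h. Put m = n + 1, r = 2m + 1 and
X = q^m. The vertices (X, 0) = t^m a t^-m and (X + 1, 1) = a t^m a t^-(m - 1)
lie on S(r), and they are at distance 2 through (X + 1, 0), outside B(r).
At height at least 0 they lie in two different branches, above the residue
classes of 0 and 1 modulo q, which a path can leave only at height 0. Since a
path to height m and back to 0 costs 2m, a vertex (x, 0) of B(r) satisfies
|x| = X or |x| <= 3 q^n, whereas a path of length at most 2m between vertices of
height 0 moves x by at most 2 q^n. The neighbours of (X, 0) other than (X, 1)
are outside B(r), so the first branch is left at some x <> X. As q - 3 > 2, a
path in B(r) needs at least 2m + 1 steps to leave the first branch, one step to
change branches and 2m steps from there to its end, hence at least 2r in all. *)
Require Import Defs.
From HB Require Import structures.
From mathcomp Require Import all_boot all_order all_algebra.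
From mathcomp Require Import boolp reals.
From mathcomp Require Import zify ring lra.

Set Implicit Arguments.
Unset Strict Implicit.
Unset Printing Implicit Defensive.

Import Order.TTheory GRing.Theory Num.Theory.

Local Open Scope ring_scope.

(** * Affine maps of the rational line *)

(* The pair (x, h) stands for the affine map y |-> l ^ h * y + x. *)
Definition affine (l : rat) (l_neq0 : l != 0) : Type := (rat * int)%type.

Section Affine.
Variables (l : rat) (l_neq0 : l != 0).
Local Notation affine := (affine l_neq0).

HB.instance Definition _ := Choice.on affine.

Definition affine_mul (u v : affine) : affine :=
  (u.1 + l ^ u.2 * v.1, u.2 + v.2).
Definition affine_one : affine := (0, 0).
Definition affine_inv (u : affine) : affine := (- (l ^ (- u.2) * u.1), - u.2).

Lemma affine_mulA : associative affine_mul.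
Proof.
move=> [x h] [y i] [z j]; rewrite /affine_mul /= expfzDr // addrA.
by congr (_, _); ring.
Qed.

Lemma affine_mul1 : left_id affine_one affine_mul.
Proof. by case=> x h; rewrite /affine_mul /= expr0z mul1r !add0r. Qed.

Lemma affine_mulr1 : right_id affine_one affine_mul.
Proof. by case=> x h; rewrite /affine_mul /= mulr0 !addr0. Qed.

Lemma affine_mulV : left_inverse affine_one affine_inv affine_mul.
Proof. by case=> x h; rewrite /affine_mul /affine_inv /= !addNr. Qed.

Lemma affine_mulrV : right_inverse affine_one affine_inv affine_mul.
Proof.
case=> x h; rewrite /affine_mul /affine_inv /= mulrN mulrA -expfzDr //.
by rewrite !subrr expr0z mul1r subrr.
Qed.

HB.instance Definition _ := isGroup.Build affine
  affine_mulA affine_mul1 affine_mulr1 affine_mulV affine_mulrV.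

End Affine.

(** * Displacement along paths of bounded length *)

(** Edges of the Cayley graph in coordinates: right multiplication by t or its inverse is vertical,
    by a or its inverse horizontal. *)
Definition step (l : rat) (u v : rat * int) : bool :=
  ((v.1 == u.1) && (`|v.2 - u.2| == 1)) ||
  ((v.2 == u.2) && (`|v.1 - u.1| == l ^ u.2)).

Lemma step_sym l : symmetric (step l).
Proof.
move=> [x h] [y i]; rewrite /step /= eq_sym (distrC h) (eq_sym i) (distrC x).
by case: eqP => [->|_] //; case: (h =P i) => [->|].
Qed.

(* [A] counts the horizontal steps and [H] is the greatest height reached;
   reaching height [H] and coming back to height [h] takes at least [2H - h]
   vertical steps. *)
Definition displacement (q len : nat) (d : rat) (h : int) : Prop :=
  exists H A : nat,
    [/\ h <= H%:Z, A%:Z + 2 * H%:Z <= len%:Z + h, `|d| <= A%:R * q%:R ^+ H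
      & (A <= 1)%N -> `|d| = q%:R ^+ H \/ q%:R * `|d| <= q%:R ^+ H].

Lemma path_displacement (q : nat) (x0 : rat) p : (0 < q)%N ->
  path (step q%:R) (x0, 0) p ->
  displacement q (size p) ((last (x0, 0) p).1 - x0) (last (x0, 0) p).2.
Proof.
move=> q_gt0; have q_ge1 : (1 : rat) <= q%:R by rewrite ler1n.
elim/last_ind: p => [|p [y i] IH].
  by move=> _; exists 0%N, 0%N; split=> //=; rewrite subrr normr0 ?mul0r ?mulr0;
    last by right.
rewrite rcons_path last_rcons size_rcons => /andP[/IH].
case: (last _ _) => x h [H [A [/= hH AH dA d1]]].
case/orP => /= /andP[/eqP-> /eqP E].
- have [Ei|Ei] : i = h + 1 \/ i = h - 1 by lia.
    have [hltH|HltH] := ltP h H%:Z.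
      by exists H, A; split=> //; lia.
    (* A new greatest height: both sides of the length bound grow by 2, and a displacement of at
       most q^H is at most a q-th of q^(H + 1). *)
    exists H.+1, A; split; [lia|lia| |].
      apply: (le_trans dA); rewrite ler_wpM2l // exprS ler_peMl //.
      by rewrite exprn_ge0 // ler0n.
    move=> A1; right; rewrite exprS ler_pM2l; last by lra.
    apply: (le_trans dA); rewrite ler_piMl ?exprn_ge0 ?ler0n //.
    by rewrite -[1]/(1%:R) ler_nat.
  by exists H, A; split=> //; lia.
have qh_le : (q%:R : rat) ^ h <= q%:R ^+ H.
  by rewrite -[_ ^+ H]/(_ ^ H%:Z); apply: ler_weXz2l.
exists H, A.+1; split; [lia|lia| |].
  rewrite -(addn1 A) natrD mulrDl mul1r.
  have -> : y - x0 = (x - x0) + (y - x) by ring.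
  by apply: le_trans (ler_normD _ _) _; rewrite lerD // E.
(* Before the first horizontal step x = x0, so the displacement is now q^h, with h = H or h + 1 <=
   H. *)
rewrite ltnS leqn0 => /eqP A0; move: dA.
rewrite A0 mul0r normr_le0 subr_eq0 => /eqP <-; rewrite E.
have [->|hneH] := eqVneq h H%:Z; [by left|right].
rewrite -{1}[q%:R]expr1z -expfzDr; last by apply/eqP; lra.
by rewrite -[_ ^+ H]/(_ ^ H%:Z); apply: ler_weXz2l => //; lia.
Qed.

(** With k = n - H, one has A <= 2k + c + 2 <= (c + 2)(k + 1), and k + 1 <= q^k. *)
Lemma horizontal_bound (q n H A c : nat) : (1 < q)%N -> (H <= n)%N ->
  (A + 2 * H <= 2 * n + c.+2)%N -> (A * q ^ H <= c.+2 * q ^ n)%N.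
Proof.
move=> q_gt1 /subnK <-; set k := (n - H)%N; rewrite expnD mulnA => Hle.
rewrite leq_mul2r; apply/orP; right.
have := ltn_expl k q_gt1; nia.
Qed.

(** Rising above height n uses up the whole budget 2(n + 1) and leaves no horizontal step. *)
Lemma displacement_even (q n len : nat) d h : (1 < q)%N ->
  displacement q len d h -> len%:Z + h <= (2 * n.+1)%:Z ->
  `|d| <= 2 * q%:R ^+ n.
Proof.
move=> q_gt1 [H [A [hH AH dA _]]] le; apply: le_trans dA _.
have [Hn|nH] := leqP H n.
  rewrite -!natrX -!natrM ler_nat; apply: horizontal_bound => //; lia.
have -> : A = 0%N by lia.
by rewrite mul0r mulr_ge0 ?exprn_ge0 ?ler0n.
Qed.

(** Height n + 1 now leaves room for one horizontal step: at the top it gives q^(n + 1), lower down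
    at most q^n. *)
Lemma displacement_odd (q n len : nat) d h : (1 < q)%N ->
  displacement q len d h -> len%:Z + h <= (2 * n.+1).+1%:Z ->
  `|d| <= 3 * q%:R ^+ n \/ `|d| = q%:R ^+ n.+1.
Proof.
move=> q_gt1 [H [A [hH AH dA d1]]] le.
have [Hn|nH] := leqP H n.
  left; apply: le_trans dA _.
  rewrite -!natrX -!natrM ler_nat; apply: horizontal_bound => //; lia.
have EH : H = n.+1 by lia.
have A1 : (A <= 1)%N by lia.
have q_gt0 : (0 : rat) < q%:R by rewrite ltr0n; lia.
case: (d1 A1); rewrite EH; first by right.
rewrite exprS ler_pM2l // => dle; left; apply: le_trans dle _.
by rewrite ler_peMl ?exprn_ge0 // ltW.
Qed.

(** * Branches modulo q *)

(* The line over the residue class of c modulo q, together with everything that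
   lies above it. *)
Definition branch (q c : nat) (u : rat * int) : bool :=
  (0 <= u.2) && ((u.1 - c%:R) / q%:R \is a Num.int).

(** From height h >= 1, a horizontal step changes x by a multiple of q, and a vertical one keeps the
    height nonnegative. *)
Lemma branch_exit (q c : nat) (u v : rat * int) : (0 < q)%N ->
  step q%:R u v -> branch q c u -> ~~ branch q c v -> u.2 = 0.
Proof.
case: u v => [x h] [y i] q_gt0; rewrite /step /branch /=.
case: h => [[|h]|h] // st /andP[_ xint]; case/negP.
case/orP: st => /andP[/eqP-> /eqP E]; first by rewrite xint andbT; lia.
apply/andP; split=> //.
have q_neq0 : (q%:R : rat) != 0 by rewrite pnatr_eq0; lia.
have -> : (y - c%:R) / q%:R = (x - c%:R) / q%:R + (y - x) / q%:R by field.
rewrite rpredD //; move/eqP: E; rewrite eqr_norml => /andP[/orP[]/eqP-> _].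
  by rewrite -[_ ^ _]/(q%:R ^+ h.+1) exprSr mulfK // rpredX // natr_int.
rewrite -[_ ^ _]/(q%:R ^+ h.+1) exprSr mulNr mulfK //.
by rewrite rpredN rpredX // natr_int.
Qed.

Lemma branch_disjoint (q : nat) u : (1 < q)%N ->
  branch q 0 u -> ~~ branch q 1 u.
Proof.
move=> q_gt1 /andP[_ u0]; apply/negP => /andP[_ u1].
have q_gt0 : (1 : rat) < q%:R by rewrite ltr1n.
have := rpredB u0 u1; rewrite -mulrBl subr0 opprB addrC subrK mul1r.
move/norm_intr_ge1; rewrite invr_eq0 ger0_norm ?invr_ge0 ?ler0n //.
by rewrite invf_ge1; lra.
Qed.

(** * Length of paths in the ball between the corners *)

Lemma split_first_exit (T : Type) (P : pred T) x p :
  P x -> ~~ P (last x p) ->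
  exists p1 y p2, [/\ p = p1 ++ y :: p2, P (last x p1) & ~~ P y].
Proof.
elim: p x => [|y p IH] x Px /=; first by rewrite Px.
have [Py /(IH _ Py)[p1 [z [p2 [-> ? ?]]]]|nPy _] := boolP (P y).
  by exists (y :: p1), z, p2.
by exists [::], y, p.
Qed.

(** Here Q = q^n and X = q^(n + 1), and the disjunction is the one of [displacement_odd]. If x <=
    3Q, then X - x >= 3Q > 2Q. *)
Lemma ball_far_from_corner (X Q x : rat) : 1 <= Q -> 6 * Q <= X ->
  `|x| <= 3 * Q \/ `|x| = X -> x <> X -> 2 * Q < X - x.
Proof.
move=> Q1 QX [|/eqP]; first by rewrite ler_norml => /andP[_ ?] _; lra.
by rewrite eqr_norml => /andP[/orP[]/eqP-> _] // _; lra.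
Qed.

Lemma corner_neighbour_far (X Q y : rat) : 1 <= Q -> 6 * Q <= X ->
  `|y - X| = 1 -> ~ (`|y| <= 3 * Q \/ `|y| = X).
Proof.
move=> Q1 QX /eqP; rewrite eqr_norml => /andP[y1 _].
have yX : y = X + 1 \/ y = X - 1 by case/orP: y1 => /eqP; lra.
by rewrite ger0_norm; case: yX => ->; lra.
Qed.

Lemma ball_path_length (q n : nat) p : (6 <= q)%N ->
  path (step q%:R) (q%:R ^+ n.+1, 0) p ->
  last (q%:R ^+ n.+1, 0) p = (q%:R ^+ n.+1 + 1, 1) ->
  (forall u, u \in p -> displacement q (2 * n.+1).+1 u.1 u.2) ->
  (2 * (2 * n.+1).+1 <= size p)%N.
Proof.
move=> q_ge6; have q_gt1 : (1 < q)%N by lia.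
have q_gt0 : (0 < q)%N by lia.
set X : rat := q%:R ^+ n.+1; set Q : rat := q%:R ^+ n => pp lastp ball.
have Q_ge1 : 1 <= Q by rewrite exprn_ege1 // ler1n.
have X_ge : 6 * Q <= X.
  by rewrite /X exprS ler_pM2r ?ler_nat //; lra.
have X_branch : branch q 0 (X, 0).
  rewrite /branch /= subr0 /X exprSr mulfK ?rpredX ?natr_int //.
  by rewrite pnatr_eq0; lia.
have X1_branch : branch q 1 (X + 1, 1).
  by rewrite /branch /= addrK; move: X_branch; rewrite /branch /= subr0.
have X1_nbranch : ~~ branch q 0 (last (X, 0) p).
  by rewrite lastp; apply/negP => /(branch_disjoint q_gt1); rewrite X1_branch.
have [p1 [y [p2 [Ep u0 y0]]]] :=
  split_first_exit (T := (rat * int)%type) X_branch X1_nbranch.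
move: pp lastp ball; rewrite Ep cat_path last_cat size_cat => /andP[pp1 pyp2].
move=> lastyp ball.
have u_height : (last (X, 0) p1).2 = 0.
  by case/andP: pyp2 => st _; exact: branch_exit st u0 y0.
have u1 : ~~ branch q 1 (last (X, 0) p1) by exact: branch_disjoint.
have ball_u : displacement q (2 * n.+1).+1 (last (X, 0) p1).1 0.
  have : last (X, 0) p1 \in (X, 0) :: p1 by exact: mem_last.
  rewrite inE => /orP[/eqP->|]; last first.
    move=> p1u; have := ball (last (X, 0) p1); rewrite mem_cat p1u u_height.
    exact.
  (* If [p1] is empty it ends at the starting corner, which [ball] need not cover. *)
  by exists n.+1, 1%N; rewrite /= ger0_norm ?exprn_ge0 ?ler0n //;
    split; [|clear; lia|rewrite mul1r|left].
have ball_y : displacement q (2 * n.+1).+1 y.1 y.2.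
  by apply: ball; rewrite mem_cat inE eqxx orbT.
have lower1 : ((2 * n.+1).+1 <= size p1)%N.
  rewrite leqNgt; apply/negP; rewrite ltnS => le1.
  have := displacement_even (n := n) q_gt1 (path_displacement q_gt0 pp1).
  rewrite u_height => /(_ ltac:(clear -le1; lia)).
  (* From (X, 0) the exit [y] would be (X, 1), in the same branch, or (X, -1) or (X + 1, 0) or (X -
     1, 0), all outside the ball. *)
  have uX : (last (X, 0) p1).1 <> X.
    case: (last _ _) u0 u_height pyp2 => x h /= u0 h0 /andP[st _] xX.
    move: st u0; rewrite {}h0 {}xX.
    case: y y0 ball_y {Ep lastyp ball} => y i /= y0 ball_y.
    rewrite /step /= expr0z => /orP[|] /andP[/eqP Ey /eqP Ei] u0.
      have {}Ei : i = 1 \/ i = -1 by clear -Ei; lia.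
      case: Ei => Ei; first by move: y0 u0; rewrite Ey Ei /branch /= => /negP.
      have := displacement_even (n := n) q_gt1 ball_y.
      by rewrite Ey Ei ger0_norm -/Q => [/(_ ltac:(clear; lia))|]; lra.
    have := displacement_odd (n := n) q_gt1 ball_y.
    rewrite Ey -/X -/Q => /(_ ltac:(clear; lia)).
    exact: corner_neighbour_far Ei.
  have := displacement_odd (n := n) q_gt1 ball_u.
  move=> /(_ ltac:(clear; lia)); rewrite -/X -/Q => uQ.
  have := ball_far_from_corner Q_ge1 X_ge uQ uX.
  by rewrite distrC => lt_ /(le_trans (ler_norm _)); rewrite leNgt lt_.
have nv : ~~ predC (branch q 1) (last (last (X, 0) p1) (y :: p2)).
  by rewrite lastyp /= X1_branch.
(* [v] is the first vertex in the branch of 1. The search starts from the end of [p1], so [v] may be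
   [y] itself. *)
have [p3 [v [p4 [Eyp w1 v1]]]] :=
  split_first_exit (T := (rat * int)%type) (P := predC (branch q 1)) u1 nv.
move: pyp2 lastyp ball; rewrite Eyp cat_path last_cat size_cat /=.
move=> /and3P[_ wv pp4] lastp4 ball.
move: v1; rewrite /= negbK => v1.
(* Read backwards, the edge into [v] leaves the branch of 1. *)
have v_height : v.2 = 0 by rewrite step_sym in wv; exact: branch_exit wv v1 w1.
have ball_v : displacement q (2 * n.+1).+1 v.1 v.2.
  by apply: ball; rewrite !mem_cat inE eqxx !orbT.
(* The final height 1 counts in the budget, so this bound is one less than [lower1]. *)
have lower4 : (2 * n.+1 <= size p4)%N.
  rewrite leqNgt; apply/negP => lt4.
  have vX : v.1 <> X.
    case: v v1 v_height {wv pp4 lastp4 ball ball_v Eyp} => x h /= v1 h0 xX.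
    by move: v1; rewrite h0 xX; apply/negP/branch_disjoint.
  case: v v_height pp4 lastp4 ball_v vX {wv v1 ball Eyp}
    => x h /= -> pp4 lastp4.
  have := displacement_even (n := n) q_gt1 (path_displacement q_gt0 pp4).
  rewrite lastp4 /= => /(_ ltac:(clear -lt4; lia)).
  move=> far ball_v xX; have := displacement_odd (n := n) q_gt1 ball_v.
  move: far; rewrite -/X -/Q => far /(_ ltac:(clear; lia)) xQ.
  have := ball_far_from_corner Q_ge1 X_ge xQ xX.
  by have := le_trans (ler_norm _) far; lra.
clear -lower1 lower4; lia.
Qed.

(** * Coordinates on BS(1, q) *)

(** Conjugating x |-> x + 1 by x |-> q x gives x |-> x + q, so the universal property of the
    presentation applies. *)
Lemma bs_coordinates (q : nat) : (0 < q)%N ->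
  exists f : BS 1 q -> rat * int,
    [/\ f 1%g = (0, 0),
        forall x y, f (x * y)%g
          = ((f x).1 + q%:R ^ (f x).2 * (f y).1, (f x).2 + (f y).2),
        f (bs_a 1 q) = (1, 0) & f (bs_t 1 q) = (0, 1)].
Proof.
move=> q_gt0; have q_neq0 : (q%:R : rat) != 0 by rewrite pnatr_eq0 -lt0n.
pose gen (b : bool) : affine q_neq0 := if b then (1, 0) else (0, 1).
have mulE u v : (u * v)%g = affine_mul u v :> affine q_neq0 by [].
have invE u : (u^-1)%g = affine_inv u :> affine q_neq0 by [].
have powE k : (gen true ^+ k)%g = (k%:R, 0).
  elim: k => [|k IH]; first by rewrite expg0.
  by rewrite expgS IH mulE /affine_mul /= expr0z mul1r addr0 -natr1 addrC.
have nseqE k : weval gen (nseq k (true, false)) = (k%:R, 0).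
  rewrite -powE; elim: k => [|k IH]; first by rewrite /weval big_nil expg0.
  by rewrite expgS -IH /weval /= big_cons.
have rel u v : bs_rel 1 q u v -> weval gen u = weval gen v.
  case; rewrite nseqE /weval /= !big_cons big_nil /= mulg1.
  rewrite !mulE invE /affine_mul /affine_inv /=.
  by congr (_, _); rewrite // ?expr1z; ring.
have [f [fM fgen]] := presented_lift rel.
exists f; split=> [|x y||].
- by apply: (mulIg (f 1%g)); rewrite -fM !mulg1 mul1g.
- by rewrite fM.
- exact: fgen true.
- exact: fgen false.
Qed.

Lemma step_mul (q : nat) (u v : rat * int) :
  v \in [:: (1, 0); (-1, 0); (0, 1); (0, -1)] ->
  step q%:R u (u.1 + q%:R ^ u.2 * v.1, u.2 + v.2).
Proof.
case: u => x h; rewrite /step !inE /= => vgen.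
rewrite ![x + _]addrC ![h + _]addrC !addrK normrM.
rewrite (ger0_norm (exprz_ge0 _ _)) //.
by case/or4P: vgen => /eqP-> /=;
   rewrite ?normrN ?normr0 ?normr1 ?mulr0 ?mulr1 ?add0r !eqxx ?orbT.
Qed.

(** * Distances in Cayley graphs *)

Section CayleyGraph.
Variables (G : groupType) (A : seq G).

Lemma dist_le_step (x y z : G) k : cayley_dist_le A x y k ->
  cayley_adj A y z -> cayley_dist_le A x z k.+1.
Proof.
move=> [p [pp lastp sizep]] yz; exists (rcons p z).
by rewrite rcons_path pp lastp yz last_rcons size_rcons ltnS.
Qed.

Lemma dist_le_mulX (x y s : G) k j : s \in A ->
  cayley_dist_le A x y k -> cayley_dist_le A x (y * s ^+ j)%g (k + j)%N.
Proof.
move=> sA; elim: j => [|j IH] xy; first by rewrite expg0 mulg1 addn0.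
rewrite addnS expgSr mulgA; apply: dist_le_step (IH xy) _.
by rewrite /cayley_adj mulKg sA.
Qed.

Lemma dist_le_mul (x y s : G) k : s \in A ->
  cayley_dist_le A x y k -> cayley_dist_le A x (y * s)%g k.+1.
Proof. by move=> sA /(dist_le_mulX 1 sA); rewrite expg1 addn1. Qed.

Lemma dist_le_refl (x : G) : cayley_dist_le A x x 0.
Proof. by exists [::]. Qed.

Lemma edge_in_ball_dist (R : realType) (r : nat) (g h : G) :
  edge_in_ball A (r%:R : R) g h -> cayley_dist_le A 1 h r.
Proof.
(* The point at parameter 1 of the edge is the vertex [h]. *)
case/andP=> gh /asboolP /(_ 1); rewrite ler01 lexx => /(_ isT).
have weaken k x : cayley_dist_le A 1 x k -> (k <= r)%N ->
    cayley_dist_le A 1 x r.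
  by move=> [p [pp lastp kp]] kr; exists p; split=> //; exact: leq_trans kr.
case=> _ [k [[dk]|[dk]]] /=; last by rewrite subrr addr0 ler_nat; exact: weaken.
rewrite natr1 ler_nat; apply: weaken; exact: dist_le_step dk gh.
Qed.

Lemma path_in_ball_dist (R : realType) (r : nat) (g : G) p :
  path (edge_in_ball A (r%:R : R)) g p ->
  forall h, h \in p -> cayley_dist_le A 1 h r.
Proof.
elim: p g => [//|y p IH] g /= /andP[gy yp] h; rewrite inE => /orP[/eqP->|].
  exact: edge_in_ball_dist gy.
exact: IH yp h.
Qed.

End CayleyGraph.

(** * The two corners and the failure of MAC *)

Lemma bs_corner_pow (q n : nat) (a := bs_a 1 q) (t := bs_t 1 q) :
  exists k, (t ^+ n * a * t ^- n = a ^+ k)%g.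
Proof.
elim: n => [|n [k IH]]; first by exists 1%N; rewrite !expg0 invg1 mulg1 mul1g.
exists (q * k)%N; have tat := bs_relation 1 q; rewrite expg1 in tat.
rewrite expgS invgM -/t !mulgA -(mulgA t) -(mulgA t) IH.
rewrite expgnA -tat.
elim: (k) => [|j IHj]; first by rewrite !expg0 mulg1 mulgV.
by rewrite !expgS -IHj !mulgA mulgVK.
Qed.

(** This rewrites the second corner g a t as a t^m a t^-(m - 1), of length 2m + 1 instead of 2m +
    3. *)
Lemma bs_corner_commute (q n : nat) (a := bs_a 1 q) (t := bs_t 1 q) :
  (a * (t ^+ n * a * t ^- n) = t ^+ n * a * t ^- n * a)%g.
Proof. by have [k ->] := bs_corner_pow q n; rewrite -expgS expgSr. Qed.

Theorem theorem4p5 (R : realType) (q : nat) (hq : (7 <= q)%N) :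
  ~ @MAC R (BS 1 q) (bs_gens 1 q).
Proof.
case=> n AC.
have q_ge6 : (6 <= q)%N by exact: ltnW.
have q_gt1 : (1 < q)%N by exact: leq_trans q_ge6.
have [f [f1 fM fa ft]] := bs_coordinates (ltnW q_gt1).
set a := bs_a 1 q in fa; set t := bs_t 1 q in ft.
have q_neq0 : (q%:R : rat) != 0 by rewrite pnatr_eq0 -lt0n ltnW.
have fV x : f x^-1%g = (- (q%:R ^ (- (f x).2) * (f x).1), - (f x).2).
  have := fM x^-1%g x; rewrite mulVg f1 => -[E1 E2].
  have E2' : (f x^-1%g).2 = - (f x).2 by lia.
  by rewrite [LHS]surjective_pairing E2'; congr (_, _); rewrite -E2'; lra.
have f_step : {homo f : g h / cayley_adj (bs_gens 1 q) g h >-> step q%:R g h}.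
  have gen_step g s : s \in bs_gens 1 q -> step q%:R (f g) (f (g * s)%g).
    move=> sA; rewrite fM; apply: step_mul.
    move: sA; rewrite !inE => /or4P[] /eqP->.
    - by rewrite fa.
    - by rewrite fV fa.
    - by rewrite ft.
    - by rewrite fV ft /= mulr0 oppr0.
  move=> g h /orP[gh|hg]; first by have := gen_step g _ gh; rewrite mulVKg.
  by have := gen_step h _ hg; rewrite mulVKg step_sym.
have f_dist g k : cayley_dist_le (bs_gens 1 q) 1%g g k ->
    displacement q k (f g).1 (f g).2.
  case=> p [pp <- sizep]; have := homo_path f_step pp; rewrite f1.
  move/(path_displacement (ltnW q_gt1)).
  rewrite -[(0, 0)]f1 last_map subr0 size_map => -[H [B [? le ? ?]]].
  by exists H, B; split=> //; apply: le_trans le _; rewrite lerD2r lez_nat.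
(* [n] is the threshold r0 of the assumed condition, so this radius exceeds it. *)
set r := (2 * n.+1).+1.
pose g := (t ^+ n.+1 * a * t ^- n.+1)%g.
have a_gen : a \in bs_gens 1 q by rewrite !inE eqxx.
have t_gen : t \in bs_gens 1 q by rewrite !inE eqxx !orbT.
have tV_gen : (t^-1)%g \in bs_gens 1 q by rewrite !inE eqxx !orbT.
have ft_pow k : f (t ^+ k)%g = (0, k%:Z).
  elim: k => [|k IH]; first by rewrite expg0.
  by rewrite expgSr fM IH ft /= mulr0 addr0 -addn1 PoszD.
have fg : f g = (q%:R ^+ n.+1, 0).
  by rewrite /g !fM fV ft_pow fa /= mulr0 oppr0 mulr0 mulr1 add0r !addr0 subrr.
have fg' : f (g * a * t)%g = (q%:R ^+ n.+1 + 1, 1).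
  by rewrite (fM _ t) (fM g) fg fa ft /= mulr0 addr0 expr0z mul1r !add0r.
have Q_ge1 : (1 : rat) <= q%:R ^+ n by rewrite exprn_ege1 // ler1n ltnW.
have X_ge : (6 * q%:R ^+ n : rat) <= q%:R ^+ n.+1.
  by rewrite exprS ler_pM2r ?ler_nat //; lra.
have g_sphere : cayley_sphere (bs_gens 1 q) r g.
  split=> [|k /f_dist].
    have := dist_le_mulX n.+1 tV_gen (dist_le_mul a_gen (dist_le_mulX n.+1 t_gen
      (dist_le_refl (bs_gens 1 q) 1%g))).
    by rewrite mul1g expVgn /r; congr (cayley_dist_le _ _ _ _); clear; lia.
  rewrite fg /= => d; rewrite leqNgt; apply/negP => kr.
  have := displacement_even (n := n) q_gt1 d.
  by rewrite ger0_norm => [/(_ ltac:(clear -kr; lia))|]; lra.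
have g'_sphere : cayley_sphere (bs_gens 1 q) r (g * a * t)%g.
  split=> [|k /f_dist].
    have := dist_le_mulX n tV_gen (dist_le_mul a_gen (dist_le_mulX n.+1 t_gen
      (dist_le_mul a_gen (dist_le_refl (bs_gens 1 q) 1%g)))).
    rewrite mul1g /g -bs_corner_commute expVgn expgS invgM.
    rewrite -/a -/t -expgS !mulgA mulgVK.
    by rewrite /r; congr (cayley_dist_le _ _ _ _); clear; lia.
  (* A length below r plus the final height 1 is at most 2(n + 1) + 1, hence the odd bound. *)
  rewrite fg' /= => d; rewrite leqNgt; apply/negP => kr.
  have := displacement_odd (n := n) q_gt1 d => /(_ ltac:(clear -kr; lia)).
  by apply: corner_neighbour_far; rewrite // addrAC subrr add0r normr1.
have gg' : cayley_dist_le (bs_gens 1 q) g (g * a * t)%g 2.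
  exact/dist_le_mul/dist_le_mul/dist_le_refl.
have [|p [pp lastp sizep]] := AC r _ _ _ g_sphere g'_sphere gg'.
  by rewrite /r; clear; lia.
have adjp : path (cayley_adj (bs_gens 1 q)) g p.
  by apply: sub_path pp => x y /andP[].
have inball u : u \in map f p -> displacement q r u.1 u.2.
  by case/mapP => h /(path_in_ball_dist pp)/f_dist + ->.
have := ball_path_length (n := n) (p := map f p) q_ge6.
rewrite -fg last_map lastp size_map.
move=> /(_ (homo_path f_step adjp) fg' inball).
by rewrite -/r -(ler_nat R) natrM; move: sizep; lra.
Qed.
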